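(* Let $n\ge 1$ be an integer. For real numbers $a_1,\dots,a_n$ with $\sum_{j=1}^n a_j=1$ put $$C(t)=\sum_{j=1}^{n}a_j\cos(2j-1)t,\qquad S(t)=\sum_{j=1}^{n}a_j\sin(2j-1)t ,$$ and let $\mathcal T\subset\mathbb R$ be the set of points at which $C$ changes sign. Then $$\min_{(a_1,\dots,a_n):\ \sum_{j=1}^n a_j=1}\ \max_{t}\left\{|S(t)|:\ t\in\mathcal T\right\}=\frac1n .$$ Moreover, the coefficients of the extremal pair of trigonometric polynomials (a pair $(C,S)$ attaining the minimum) are uniquely determined.
   Context: The function $C$ ''changes sign'' at a point $t_0$ if $C(t_0)=0$ and $C$ takes values of opposite signs immediately to the left and immediately to the right of $t_0$. *)

(* Defs.v *)
From mathcomp Require Export all_boot all_order all_algebra.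
From mathcomp Require Export all_classical all_reals all_analysis.

Set Implicit Arguments.
Unset Strict Implicit.
Unset Printing Implicit Defensive.

Import Order.TTheory GRing.Theory Num.Theory.
Import numFieldNormedType.Exports.

Local Open Scope classical_set_scope.
Local Open Scope ring_scope.

(* The index j : 'I_n runs over 0, ..., n - 1, so the frequency 2j - 1 of the
   1-based convention becomes 2j + 1. *)
Definition cosSum (R : realType) (n : nat) (a : 'rV[R]_n) (t : R) : R :=
  \sum_(j < n) a ord0 j * cos ((2 * j + 1)%:R * t).

Definition sinSum (R : realType) (n : nat) (a : 'rV[R]_n) (t : R) : R :=
  \sum_(j < n) a ord0 j * sin ((2 * j + 1)%:R * t).

Definition changes_sign (R : realType) (f : R -> R) (t0 : R) : Prop :=
  f t0 = 0 /\
  (((\forall t \near t0^'-, f t < 0) /\ (\forall t \near t0^'+, 0 < f t)) \/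
   ((\forall t \near t0^'-, 0 < f t) /\ (\forall t \near t0^'+, f t < 0))).

Definition is_maximum (R : realType) (A : set R) (m : R) : Prop :=
  A m /\ ubound A m.

Definition is_minimum (R : realType) (A : set R) (m : R) : Prop :=
  A m /\ lbound A m.

Definition normalized (R : realType) (n : nat) (a : 'rV[R]_n) : Prop :=
  \sum_(j < n) a ord0 j = 1.

Definition sign_change_values (R : realType) (n : nat) (a : 'rV[R]_n) : set R :=
  [set `|sinSum a t| | t in [set t | changes_sign (cosSum a) t]].

(* Main.v *)
(* With x = cos 2t one has C(t) = cos t N(x) and S(t) = sin t W(x) for polynomials
   N, W of degree < n. Put P = (1 + X) N. If P(y) = 0, the n-point quadrature rule
   mu with nodes cos(2 pi m / n) satisfies mu(P / (X - y)) = W(y).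

   Let r_0 > r_1 > ... > r_q = -1 be the sign changes of N in ]-1, 1[ followed by
   -1, let Q = prod (X - r_k) and P = Q M with M >= 0 on [-1, 1]. Let L >= 0 have
   degree <= q and vanish at r_1, r_3, ..., so that L = sum lam_k Q / (X - r_k)
   with all lam_k >= 0 and lam_0 > 0. Since 1 is a node,
     M(1) L(1) / n <= mu(M L) = sum lam_k W(r_k),
   while |S| <= m at the sign changes gives W(r_k) <= 2 m / (1 - r_k), strictly
   for r_k > -1 (because sin^2 <= sin); and sum 2 lam_k / (1 - r_k) = M(1) L(1).
   Hence m >= 1/n, and equality forces N >= 0 with N = 0 at all nodes but 1. These
   zeros are double in t, and discrete orthogonality recovers the coefficients.
   They are those of the odd part of the Fejer kernel:
   n^2 C(t) sin^2 t = sin^2(nt) cos t. *)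

Require Import Defs.
From mathcomp Require Import all_boot all_order all_algebra.
From mathcomp Require Import all_classical all_reals all_analysis.
From mathcomp Require Import ring lra zify.

Set Implicit Arguments.
Unset Strict Implicit.
Unset Printing Implicit Defensive.
Import Order.TTheory GRing.Theory Num.Theory.
Import numFieldNormedType.Exports.

Local Open Scope classical_set_scope.
Local Open Scope ring_scope.

(** * Chebyshev-type polynomials in cos 2t and their divided differences *)

Lemma cos_double (R : realType) (t : R) : cos (2 * t) = 2 * cos t ^+ 2 - 1.
Proof. by rewrite mulr_natl cos_mulr2n -mulr_natl. Qed.

Lemma nat_ind2 (P : nat -> Prop) :
  P 0%N -> P 1%N -> (forall k, P k -> P k.+1 -> P k.+2) -> forall k, P k.
Proof.
move=> P0 P1 PS k; suff [] : P k /\ P k.+1 by [].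
by elim: k => // k [Pk Pk1]; split=> //; apply: PS.
Qed.

(* v_j(cos 2t) = cos (2j+1)t / cos t *)
Fixpoint cosQuot (R : comNzRingType) (x : R) (j : nat) : R :=
  if j is j'.+1 then
    if j' is j''.+1 then 2 * x * cosQuot x j' - cosQuot x j'' else 2 * x - 1
  else 1.

(* w_j(cos 2t) = sin (2j+1)t / sin t *)
Fixpoint sinQuot (R : comNzRingType) (y : R) (j : nat) : R :=
  if j is j'.+1 then
    if j' is j''.+1 then 2 * y * sinQuot y j' - sinQuot y j'' else 2 * y + 1
  else 1.

(* The divided difference (P_j(X) - P_j(y)) / (X - y) of P_j = (1 + X) v_j.
   The recursion is in y rather than in X: then the quadrature rule only has to
   evaluate the P_j, and it returns w_j(y). *)
Fixpoint diffQuot (R : comNzRingType) (y : R) (j : nat) : {poly R} :=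
  if j is j'.+1 then
    if j' is j''.+1 then
      (2 * y) *: diffQuot y j' + 2 *: (('X + 1) * cosQuot 'X j') - diffQuot y j''
    else 2 *: 'X + (2 * y + 1)%:P
  else 1.

Lemma cosQuotSS (R : comNzRingType) (x : R) j :
  cosQuot x j.+2 = 2 * x * cosQuot x j.+1 - cosQuot x j.
Proof. by []. Qed.

Lemma sinQuotSS (R : comNzRingType) (x : R) j :
  sinQuot x j.+2 = 2 * x * sinQuot x j.+1 - sinQuot x j.
Proof. by []. Qed.

Lemma diffQuotSS (R : comNzRingType) (y : R) j :
  diffQuot y j.+2 = (2 * y) *: diffQuot y j.+1 +
     2 *: (('X + 1) * cosQuot 'X j.+1) - diffQuot y j.
Proof. by []. Qed.

Lemma horner_cosQuot (R : comNzRingType) (x : R) j :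
  (cosQuot 'X j).[x] = cosQuot x j.
Proof.
elim/nat_ind2: j => [||j IH0 IH1].
- by rewrite hornerC.
- by rewrite /= hornerD hornerN mulr_natl hornerMn hornerX hornerC mulr_natl.
rewrite cosQuotSS hornerD hornerN IH0 -mulrA mulr_natl hornerMn.
by rewrite -commr_polyX hornerMX IH1 cosQuotSS -mulr_natl; ring.
Qed.

(** The induction step rests on 2 X P(X) - 2 y P(y) = 2 y (P(X) - P(y)) + 2 (X - y) P(X), whose last
    term is the source of the inhomogeneous term of [diffQuot]. *)
Lemma diffQuotP (R : comNzRingType) (y : R) j :
  ('X - y%:P) * diffQuot y j =
  ('X + 1) * cosQuot 'X j - ((y + 1) * cosQuot y j)%:P.
Proof.
elim/nat_ind2: j => [||j IH0 IH1]; rewrite ?cosQuotSS ?diffQuotSS.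
- by rewrite /= !mulr1 polyCD; ring.
- by rewrite /= -!mul_polyC !(polyC_natr, polyCM, polyCD, polyCB); ring.
rewrite mulrBr IH0 mulrDr -scalerAr IH1.
by rewrite -!mul_polyC !(polyC_natr, polyCM, polyCD, polyCB); ring.
Qed.

(** Stated as a product, the identity survives where [cos t] vanishes. The recursion is the
    sum-to-product formula for the frequencies 2j + 1 and 2j + 5. *)
Lemma cosQuot_cos (R : realType) (t : R) j :
  cosQuot (cos (2 * t)) j * cos t = cos ((2 * j + 1)%:R * t).
Proof.
have c2 := cos_double t.
elim/nat_ind2: j => [||j IH0 IH1].
- by rewrite /= !mul1r.
- have -> : (2 * 1 + 1)%:R * t = 2 * t + t by ring.
  rewrite cosD /= mulrC c2 [2 * t]mulr_natl sin_mulr2n.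
  have -> : (cos t * sin t *+ 2) * sin t = 2 * cos t * sin t ^+ 2 by ring.
  by rewrite sin2cos2; ring.
rewrite cosQuotSS.
transitivity (2 * cos (2 * t) * (cosQuot (cos (2 * t)) j.+1 * cos t) -
  cosQuot (cos (2 * t)) j * cos t); first by ring.
rewrite IH0 IH1.
have -> : (2 * j.+2 + 1)%:R * t = (2 * j.+1 + 1)%:R * t + 2 * t.
  by rewrite -mulrDl -natrD; congr (_%:R * _); lia.
have -> : (2 * j + 1)%:R * t = (2 * j.+1 + 1)%:R * t - 2 * t.
  by rewrite -mulrBl -natrB; [congr (_%:R * _); lia|lia].
by rewrite cosB cosD; ring.
Qed.

Lemma sinQuot_sin (R : realType) (t : R) j :
  sinQuot (cos (2 * t)) j * sin t = sin ((2 * j + 1)%:R * t).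
Proof.
have c2 := cos_double t.
elim/nat_ind2: j => [||j IH0 IH1].
- by rewrite /= !mul1r.
- have -> : (2 * 1 + 1)%:R * t = 2 * t + t by ring.
  by rewrite sinD /= c2 [2 * t]mulr_natl sin_mulr2n; ring.
rewrite sinQuotSS.
transitivity (2 * cos (2 * t) * (sinQuot (cos (2 * t)) j.+1 * sin t) -
  sinQuot (cos (2 * t)) j * sin t); first by ring.
rewrite IH0 IH1.
have -> : (2 * j.+2 + 1)%:R * t = (2 * j.+1 + 1)%:R * t + 2 * t.
  by rewrite -mulrDl -natrD; congr (_%:R * _); lia.
have -> : (2 * j + 1)%:R * t = (2 * j.+1 + 1)%:R * t - 2 * t.
  by rewrite -mulrBl -natrB; [congr (_%:R * _); lia|lia].
by rewrite sinB sinD; ring.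
Qed.

(** * The quadrature rule at the nodes cos (2 pi m / n) *)

Definition nodeAngle (R : realType) (n m : nat) : R := m%:R * pi / n%:R.

Definition nodeMean (R : realType) (n : nat) (p : {poly R}) : R :=
  n%:R^-1 * \sum_(m < n) p.[cos (2 * nodeAngle R n m)].

Lemma nodeMeanD (R : realType) n (p q : {poly R}) :
  nodeMean n (p + q) = nodeMean n p + nodeMean n q.
Proof.
rewrite /nodeMean -mulrDr -big_split; congr (_ * _).
by apply: eq_bigr => i _; rewrite hornerD.
Qed.

Lemma nodeMeanZ (R : realType) n c (p : {poly R}) :
  nodeMean n (c *: p) = c * nodeMean n p.
Proof.
rewrite /nodeMean [RHS]mulrCA; congr (_ * _); rewrite mulr_sumr.
by apply: eq_bigr => i _; rewrite hornerZ.
Qed.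

Lemma nodeMeanN (R : realType) n (p : {poly R}) :
  nodeMean n (- p) = - nodeMean n p.
Proof. by rewrite -scaleN1r nodeMeanZ mulN1r. Qed.

Lemma nodeMean_sum (R : realType) n (I : Type) (r : seq I) (F : I -> {poly R}) :
  nodeMean n (\sum_(i <- r) F i) = \sum_(i <- r) nodeMean n (F i).
Proof.
apply: (big_morph _ (nodeMeanD n)).
by rewrite /nodeMean big1 ?mulr0 // => i _; rewrite horner0.
Qed.

Lemma nodeMeanC (R : realType) n (c : R) : (0 < n)%N -> nodeMean n c%:P = c.
Proof.
move=> n0; rewrite /nodeMean (eq_bigr (fun=> c)); last by move=> *; rewrite hornerC.
by rewrite sumr_const card_ord -[c *+ n]mulr_natl mulrA mulVf ?mul1r // pnatr_eq0 -lt0n.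
Qed.

Lemma cos_natMpi (R : realType) k : cos (k%:R * pi) = (-1) ^+ k :> R.
Proof.
by elim: k => [|k IH]; rewrite ?mul0r ?cos0 // -natr1 mulrDl mul1r cosDpi IH exprS mulN1r.
Qed.

Lemma sin_natMpi (R : realType) k : sin (k%:R * pi) = 0 :> R.
Proof.
by elim: k => [|k IH]; rewrite ?mul0r ?sin0 // -natr1 mulrDl mul1r sinDpi IH oppr0.
Qed.

(** Multiplying by 2 sin h, with h = i pi / n, makes the sum telescope. The two ends cancel because
    sin ((2n - 1) h) = - sin h, and sin h is nonzero as 0 < h < pi. *)
Lemma sum_cos_nodes (R : realType) n i : (0 < i < n)%N ->
  \sum_(m < n) cos (i%:R * (2 * nodeAngle R n m)) = 0.
Proof.
move=> /andP[i0 iN]; have n0 : (n%:R : R) != 0 by rewrite pnatr_eq0; lia.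
set h : R := i%:R * pi / n%:R.
have sh : sin h != 0.
  rewrite gt_eqF // sin_gt0_pi // /h divr_gt0 ?mulr_gt0 ?pi_gt0 ?ltr0n//=; last lia.
  by rewrite ltr_pdivrMr ?ltr0n ?ltr_pM2r ?pi_gt0 1?mulrC ?ltr_pM2l ?pi_gt0 ?ltr_nat//; lia.
have E k : (2 * sin h) * \sum_(m < k) cos (i%:R * (2 * nodeAngle R n m)) =
   sin ((2 * k%:R - 1) * h) + sin h.
  elim: k => [|k IH]; first by rewrite big_ord0 !mulr0 sub0r mulN1r sinN addNr.
  rewrite big_ord_recr /= mulrDr IH.
  have -> : i%:R * (2 * nodeAngle R n k) = 2 * k%:R * h by rewrite /h /nodeAngle; field.
  have -> : (2 * k.+1%:R - 1) * h = 2 * k%:R * h + h by rewrite -natr1; ring.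
  have -> : (2 * k%:R - 1) * h = 2 * k%:R * h - h by ring.
  by rewrite sinB sinD; ring.
apply: (mulfI (mulf_neq0 (_ : 2 != 0) sh)) => //.
rewrite E mulr0.
have -> : (2 * n%:R - 1) * h = (2 * i)%:R * pi - h by rewrite natrM /h; field.
by rewrite sinB sin_natMpi cos_natMpi exprM sqrrN expr1n expr1n; ring.
Qed.

(** At x = cos 2t the polynomial equals 2 cos t cos (2j + 3)t, the sum of the cosines of (j + 2)(2t)
    and (j + 1)(2t): two nonzero frequencies below n. *)
Lemma nodeMean_cosQuot (R : realType) n j : (j.+2 < n)%N ->
  nodeMean n (('X + 1) * cosQuot 'X j.+1) = 0 :> R.
Proof.
move=> jn; rewrite /nodeMean.
rewrite (eq_bigr (fun m : 'I_n => cos (j.+2%:R * (2 * nodeAngle R n m)) +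
  cos (j.+1%:R * (2 * nodeAngle R n m)))) => [|m _].
  by rewrite big_split /= !sum_cos_nodes ?addr0 ?mulr0 //; lia.
rewrite hornerM hornerD hornerX hornerC horner_cosQuot.
set t := nodeAngle _ _ _.
rewrite {1}cos_double subrK expr2 -!mulrA [cos t * cosQuot _ _]mulrC cosQuot_cos.
have -> : j.+2%:R * (2 * t) = (2 * j.+1 + 1)%:R * t + t.
  by rewrite -(natr1 j.+1) natrD natrM; ring.
have -> : j.+1%:R * (2 * t) = (2 * j.+1 + 1)%:R * t - t.
  by rewrite natrD natrM; ring.
by rewrite cosB cosD; ring.
Qed.

(** The rule kills the inhomogeneous term in the recursion of [diffQuot], so the means obey the
    recursion of [sinQuot]. *)
Lemma nodeMean_diffQuot (R : realType) n (y : R) j : (j < n)%N ->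
  nodeMean n (diffQuot y j) = sinQuot y j.
Proof.
elim/nat_ind2: j => [||j IH0 IH1] jn.
- by rewrite nodeMeanC //; lia.
- rewrite /= nodeMeanD nodeMeanZ nodeMeanC; last lia.
  rewrite /nodeMean (eq_bigr (fun m : 'I_n => cos (1%:R * (2 * nodeAngle R n m)))).
    by rewrite sum_cos_nodes //; ring.
  by move=> i _; rewrite hornerX mul1r.
rewrite diffQuotSS sinQuotSS nodeMeanD nodeMeanN nodeMeanD !nodeMeanZ.
by rewrite nodeMean_cosQuot // IH0 ?IH1 ?mulr0 ?addr0 //; lia.
Qed.

(** * The polynomial N ([cosPoly]) and the function W ([sinQuotSum]) of a coefficient row *)

Definition cosPoly (R : realType) n (a : 'rV[R]_n) : {poly R} :=
  \sum_(j < n) a ord0 j *: cosQuot 'X j.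

Lemma cosPolyE (R : realType) n (a : 'rV[R]_n) t :
  cosSum a t = cos t * (cosPoly a).[cos (2 * t)].
Proof.
rewrite /cosPoly horner_sum mulr_sumr; apply: eq_bigr => j _.
by rewrite hornerZ horner_cosQuot -cosQuot_cos; ring.
Qed.

Definition sinQuotSum (R : realType) n (a : 'rV[R]_n) (y : R) : R :=
  \sum_(j < n) a ord0 j * sinQuot y j.

Lemma sinQuotSumE (R : realType) n (a : 'rV[R]_n) t :
  sinSum a t = sin t * sinQuotSum a (cos (2 * t)).
Proof.
rewrite mulr_sumr; apply: eq_bigr => j _.
by rewrite -sinQuot_sin; ring.
Qed.

Lemma cosPoly1 (R : realType) n (a : 'rV[R]_n) :
  (cosPoly a).[1] = \sum_(j < n) a ord0 j.
Proof.
rewrite horner_sum; apply: eq_bigr => j _.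
rewrite hornerZ horner_cosQuot -{1}(@cos0 R) -[X in cos X](mulr0 2).
by rewrite -[cosQuot _ _]mulr1 -[X in _ * (_ * X)](@cos0 R) cosQuot_cos mulr0 cos0 mulr1.
Qed.

(** The hypothesis makes P = (1 + X) N vanish at y, so the constants in [diffQuotP] add up to zero
    and G is the combination of the [diffQuot y j]. Linearity of the rule does the rest. *)
Lemma nodeMean_divided_difference (R : realType) n (a : 'rV[R]_n) (y : R)
  (G : {poly R}) :
  ('X - y%:P) * G = ('X + 1) * cosPoly a -> nodeMean n G = sinQuotSum a y.
Proof.
move=> GE.
have Py : (y + 1) * (cosPoly a).[y] = 0.
  have := congr1 (horner^~ y) GE.
  by rewrite !hornerM hornerXsubC subrr mul0r hornerD hornerX hornerC => <-.
pose G' := \sum_(j < n) a ord0 j *: diffQuot y j.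
have -> : G = G'.
  have X0 : ('X - y%:P : {poly R}) != 0 by rewrite polyXsubC_eq0.
  apply: (mulfI X0).
  rewrite GE /G' /cosPoly !mulr_sumr.
  transitivity (\sum_(j < n) (a ord0 j *: (('X + 1) * cosQuot 'X j))
     - ((y + 1) * (cosPoly a).[y])%:P).
    by rewrite Py subr0; apply: eq_bigr => j _; rewrite -scalerAr.
  rewrite /cosPoly horner_sum mulr_sumr rmorph_sum -sumrB.
  apply: eq_bigr => j _; rewrite -scalerAr diffQuotP scalerBr; congr (_ - _).
  by rewrite hornerZ horner_cosQuot mulrCA -mul_polyC [LHS]polyCM.
rewrite /G' nodeMean_sum; apply: eq_bigr => j _.
by rewrite nodeMeanZ nodeMean_diffQuot.
Qed.

(** * Sign-change factorization, interpolation and the dual polynomial *)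

Lemma seq_ind2 (T : Type) (P : seq T -> Prop) :
  P [::] -> (forall x, P [:: x]) -> (forall x y s, P s -> P [:: x, y & s]) ->
  forall s, P s.
Proof.
move=> P0 P1 PS s; suff [] : P s /\ forall x, P (x :: s) by [].
by elim: s => // y s [Ps Pys]; split=> // x; apply: PS.
Qed.

(* [s] is the set of sign changes of [p] in ]-1, 1[. *)
Lemma poly_sign_change_split (R : rcfType) (p : {poly R}) : p != 0 ->
  exists s M, [/\ uniq s, all (fun r => -1 < r < 1) s,
    p = \prod_(r <- s) ('X - r%:P) * M &
    forall x y, -1 <= x <= 1 -> -1 <= y <= 1 -> 0 <= M.[x] * M.[y]].
Proof.
have [k] := ubnP (size p); elim: k p => // k IH p szp p0.
have [[r rI rp]|nor] := pselect (exists2 r, -1 < r < 1 & root p r); last first.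
  exists [::], p; split=> //; first by rewrite big_nil mul1r.
  (* By the intermediate value theorem opposite signs would yield a root between u and v; it differs
     from both, hence is interior. *)
  have key u v : -1 <= u <= 1 -> -1 <= v <= 1 -> p.[u] < 0 -> 0 < p.[v] -> False.
    move=> uI vI pu pv.
    have [uv|vu] := leP u v.
      have [|r /andP[ur rv] rr] := @poly_ivt _ p u v uv; first by rewrite !ltW.
      move/eqP: (rr) => r0; apply: nor; exists r => //.
      have ? : u != r by apply: contraTneq pu => ->; rewrite r0 ltxx.
      have ? : r != v by apply: contraTneq pv => <-; rewrite r0 ltxx.
      have : u < r by rewrite lt_neqAle; apply/andP.
      have : r < v by rewrite lt_neqAle; apply/andP.
      by lra.
    have [|r /andP[ur rv] rr] := @poly_ivt _ (- p) v u (ltW vu).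
      by rewrite !hornerN; apply/andP; split; lra.
    rewrite rootN in rr; move/eqP: (rr) => r0; apply: nor; exists r => //.
    have ? : v != r by apply: contraTneq pv => ->; rewrite r0 ltxx.
    have ? : r != u by apply: contraTneq pu => <-; rewrite r0 ltxx.
    have : v < r by rewrite lt_neqAle; apply/andP.
    have : r < u by rewrite lt_neqAle; apply/andP.
    by lra.
  move=> x y xI yI; rewrite leNgt; apply/negP => /[dup] h.
  case: (ltrgt0P p.[x]) => [px|px|->]; last by rewrite mul0r ltxx.
    by rewrite pmulr_rlt0 // => /(key _ _ yI xI); apply.
  by rewrite (nmulr_rlt0 _ px); apply: key px.
have [q pE] : exists q, p = q * ('X - r%:P) by apply/factor_theorem.
have q0 : q != 0 by apply: contraNneq p0 => q0; rewrite pE q0 mul0r.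
have [|s [M [us sI qE MI]]] := IH q _ q0.
  by move: szp; rewrite pE size_Mmonic ?monicXsubC // size_XsubC; lia.
have [rs|rs] := boolP (r \in s); last first.
  exists (r :: s), M; split=> //=; [by rewrite rs|by rewrite rI|].
  by rewrite big_cons pE qE; ring.
(* Here r already occurs in [s]: the two linear factors form a square, which joins M without
   affecting its sign. *)
exists (rem r s), (('X - r%:P) ^+ 2 * M); split.
- exact: rem_uniq.
- by apply/allP => z /mem_rem zs; exact: (allP sI).
- by rewrite pE qE (perm_big _ (perm_to_rem rs)) big_cons /=; ring.
move=> x y xI yI; rewrite !hornerM.
set a := ('X - _).[x]; set b := ('X - _).[y].
have -> : a * a * M.[x] * (b * b * M.[y]) = (a * b) ^+ 2 * (M.[x] * M.[y]) by ring.
by rewrite mulr_ge0 ?sqr_ge0 ?MI.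
Qed.

(** The difference of the two sides has size at most [size s] and vanishes on all of [s]. *)
Lemma lagrange_interpolation (R : fieldType) (s : seq R) (p : {poly R}) :
  uniq s -> (size p <= size s)%N ->
  p = \sum_(r <- s) (p.[r] / \prod_(r' <- rem r s) (r - r')) *:
        \prod_(r' <- rem r s) ('X - r'%:P).
Proof.
move=> us szp; apply/eqP; rewrite -subr_eq0; apply/eqP.
set q := \sum_(_ <- _) _.
apply: (@roots_geq_poly_eq0 _ _ s) => //; last first.
  rewrite (leq_trans (size_polyD _ _)) // geq_max szp size_polyN /=.
  rewrite /q big_seq; apply: (leq_trans (size_sum _ _ _)).
  apply/bigmax_leqP_seq => r _ rs; apply: (leq_trans (size_scale_leq _ _)).
  by rewrite size_prod_XsubC size_rem // prednK //; case: (s) rs.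
apply/allP => z zs; rewrite rootE hornerD hornerN horner_sum.
rewrite (bigD1_seq z) //= [X in _ - (_ + X)]big1_seq ?addr0 => [|r /andP[rz rs]]; last first.
  rewrite hornerZ (_ : (\prod_(r' <- _) _).[z] = 0) ?mulr0 //.
  by apply/eqP; rewrite -rootE root_prod_XsubC mem_rem_uniq // inE eq_sym rz.
rewrite hornerZ horner_prod; under [X in _ * X]eq_bigr do rewrite hornerXsubC.
rewrite divfK ?subrr // prodf_seq_neq0; apply/allP => r'.
by rewrite mem_rem_uniq // inE subr_eq0 eq_sym => /andP[].
Qed.

(* The interpolated polynomial of the duality argument: for decreasing
   r0 > r1 > ..., it vanishes at r1, r3, ... (doubly, except at a last root
   of odd index), so it is nonnegative beyond the last root and all its
   interpolation weights are nonnegative. *)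
Fixpoint altPoly (R : nzRingType) (s : seq R) : {poly R} :=
  if s is _ :: s1 then
    if s1 is r1 :: s2 then
      if s2 is [::] then 'X - r1%:P else ('X - r1%:P) ^+ 2 * altPoly s2
    else 1
  else 1.

Lemma size_altPoly (R : idomainType) (s : seq R) :
  s != [::] -> (size (altPoly s) <= size s)%N.
Proof.
elim/seq_ind2: s => [|x|x y [|z s] IH] // _; first by rewrite size_polyC; case: (_ != 0).
  by rewrite size_XsubC.
rewrite [altPoly _]/(_ * altPoly (z :: s)); apply: (leq_trans (size_polyMleq _ _)).
have := IH isT; rewrite size_exp_XsubC /=; lia.
Qed.

Lemma altPoly_ge0 (R : realDomainType) (s : seq R) (x : R) :
  last x s <= x -> 0 <= (altPoly s).[x].
Proof.
elim/seq_ind2: s => [|r|r y [|z s] IH] //=; rewrite ?hornerC ?ler01 //.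
  by rewrite hornerXsubC subr_ge0.
by move=> h; rewrite hornerM horner_exp mulr_ge0 ?sqr_ge0 // IH.
Qed.

Lemma altPoly_gt0 (R : realDomainType) (s : seq R) (x : R) :
  all (fun r => r < x) s -> 0 < (altPoly s).[x].
Proof.
elim/seq_ind2: s => [|r|r y [|z s] IH] //=; rewrite ?hornerC ?ltr01 //.
  by case/and3P=> _ h _; rewrite hornerXsubC subr_gt0.
case/and3P=> _ yx h; rewrite hornerM horner_exp mulr_gt0 ?IH //.
by rewrite hornerXsubC exprn_gt0 // subr_gt0.
Qed.

Lemma gt_sorted_cons (R : realDomainType) (r : R) s :
  sorted >%R (r :: s) = all (fun r' => r' < r) s && sorted >%R s.
Proof. by rewrite /= path_sortedE //; apply/rev_trans/lt_trans. Qed.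

Lemma prod_sub_gt0 (R : realDomainType) (x : R) s :
  all (fun r => r < x) s -> 0 < \prod_(r <- s) (x - r).
Proof.
by move/allP => h; rewrite big_seq prodr_gt0 // => r /h; rewrite subr_gt0.
Qed.

Lemma altPoly_head_gt0 (R : realDomainType) (r : R) s :
  sorted >%R (r :: s) -> 0 < (altPoly (r :: s)).[r].
Proof.
rewrite gt_sorted_cons => /andP[sr _].
case: s sr => [|r1 [|r2 s]]; first by rewrite hornerC ltr01.
  by rewrite /= andbT hornerXsubC subr_gt0.
case/andP=> r1r hs; have h : 0 < (altPoly (r2 :: s)).[r] by apply: altPoly_gt0.
rewrite [altPoly _]/(_ * altPoly (r2 :: s)).
by rewrite hornerM horner_exp hornerXsubC mulr_gt0 // exprn_gt0 // subr_gt0.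
Qed.

(** Multiplying instead of dividing by the node product keeps the sign of the Lagrange weight. The
    induction removes the two largest points: at the first everything is positive, at the second
    [altPoly] vanishes, and below both the two extra differences are negative. *)
Lemma altPoly_weight_ge0 (R : realDomainType) (s : seq R) (r : R) :
  sorted >%R s -> r \in s ->
  0 <= (altPoly s).[r] * \prod_(r' <- rem r s) (r - r').
Proof.
elim/seq_ind2: s r => [|x|x y s IH] r //.
  by rewrite inE => _ /eqP ->; rewrite /= eqxx big_nil hornerC mulr1 ler01.
move=> sxy; have := sxy; rewrite 2!gt_sorted_cons => /andP[/andP[yx sx] /andP[sy ss]].
have [-> _|rx] := eqVneq r x.
  rewrite ltW // mulr_gt0 ?altPoly_head_gt0 // [rem _ _]/= eqxx prod_sub_gt0 //=.
  by rewrite yx.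
rewrite inE (negPf rx) inE; have [-> _|ry rs] := eqVneq r y.
  have -> : (altPoly [:: x, y & s]).[y] = 0.
    by case: (s) => [|z s'] /=; rewrite ?hornerM ?horner_exp hornerXsubC subrr ?expr0n ?mul0r.
  by rewrite mul0r.
have -> : altPoly [:: x, y & s] = ('X - y%:P) ^+ 2 * altPoly s by case: (s) rs.
rewrite [rem _ _]/= ![_ == r]eq_sym (negPf rx) (negPf ry) !big_cons.
rewrite hornerM horner_exp; set c := _ ^+ 2; set A := _.[r]; set B := \prod_(_ <- _) _.
have -> : c * A * ((r - x) * ((r - y) * B)) = c * ((x - r) * (y - r)) * (A * B) by ring.
have rly : r < y by move/allP: sy; apply.
by rewrite mulr_ge0 ?IH // mulr_ge0 ?sqr_ge0 // mulr_ge0 // subr_ge0 ltW // (lt_trans rly).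
Qed.

(** * From the roots of N to the sign changes of C *)

(** Once the root [c x] is divided out with its multiplicity, the cofactor is nonzero at [c x],
    hence nearby by continuity. *)
Lemma near_horner_neq0 (R : realType) (p : {poly R}) (c : R -> R) (x : R) :
  p != 0 -> {for x, continuous c} ->
  \forall t \near x, c t != c x -> p.[c t] != 0.
Proof.
move=> p0 cx; have [m [q /implyP/(_ p0) qx ->]] := multiplicity_XsubC p (c x).
have qc : {for x, continuous (fun t => q.[c t])}.
  by apply: continuous_comp => //; apply: continuous_horner.
have : \forall t \near x, q.[c t] != 0 by apply: (cvgr_neq0 _ qc).
apply: filterS => t qt ct; rewrite hornerM horner_exp hornerXsubC.
by rewrite mulf_neq0 // expf_neq0 // subr_eq0.
Qed.

(** The factor [u] carries the sign change and [g] keeps its sign near x. The factor [p.[c t]] may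
    vanish at x itself, but is positive at nearby t with [c t != c x]. *)
Lemma changes_sign_factor (R : realType) (f u g c : R -> R) (p : {poly R}) (x : R) :
  (forall t, f t = u t * g t * p.[c t]) ->
  p != 0 -> (forall t, 0 <= p.[c t]) ->
  {for x, continuous c} -> {for x, continuous g} -> g x != 0 -> u x = 0 ->
  (\forall t \near x, t < x -> 0 < u t /\ c t != c x) ->
  (\forall t \near x, x < t -> u t < 0 /\ c t != c x) ->
  changes_sign f x.
Proof.
move=> fE p0 pge cx gx g0 u0 ul ur; split; first by rewrite fE u0 !mul0r.
have pn := near_horner_neq0 p0 cx.
have ppos t : p.[c t] != 0 -> 0 < p.[c t] by rewrite lt0r pge andbT.
have near_left (P : R -> Prop) :
  (\forall t \near x, t < x -> P t) -> \forall t \near x^'-, P t by [].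
have near_right (P : R -> Prop) :
  (\forall t \near x, x < t -> P t) -> \forall t \near x^'+, P t by [].
have [gn|gp|ge] := ltgtP (g x) 0; last by rewrite ge eqxx in g0.
- have gt : \forall t \near x, g t < 0 by apply: (cvgr_lt _ gx).
  left; split; [apply: near_left|apply: near_right].
    apply: filterS3 ul pn gt => t ut pt gt /ut[up /pt/ppos pp].
    by rewrite fE pmulr_llt0 // pmulr_rlt0.
  apply: filterS3 ur pn gt => t ut pt gt /ut[un /pt/ppos pp].
  by rewrite fE pmulr_lgt0 // nmulr_rgt0.
have gt : \forall t \near x, 0 < g t by apply: (cvgr_gt _ gx).
right; split; [apply: near_left|apply: near_right].
  apply: filterS3 ul pn gt => t ut pt gt /ut[up /pt/ppos pp].
  by rewrite fE pmulr_lgt0 // pmulr_rgt0.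
apply: filterS3 ur pn gt => t ut pt gt /ut[un /pt/ppos pp].
by rewrite fE pmulr_llt0 // nmulr_rlt0.
Qed.

Lemma cos_range (R : realType) (t : R) : -1 <= cos t <= 1.
Proof. by rewrite cos_geN1 cos_le1. Qed.

Lemma continuous_cos_double (R : realType) : continuous (fun t : R => cos (2 * t)).
Proof.
move=> t; apply: continuous_comp; last exact: continuous_cos.
exact: mulrl_continuous.
Qed.

Lemma continuous_horner_cos (R : realType) (p : {poly R}) :
  continuous (fun t : R => p.[cos (2 * t)]).
Proof.
move=> t; apply: continuous_comp; first exact: continuous_cos_double.
exact: continuous_horner.
Qed.

(** The factor that changes sign is cos 2t - cos 2x, since cos 2t decreases on ]0, pi / 2[. *)
Lemma changes_sign_interior (R : realType) n (a : 'rV[R]_n) (x : R)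
    (q M : {poly R}) :
  0 < x < pi / 2 -> cosPoly a = ('X - (cos (2 * x))%:P) * q * M ->
  q.[cos (2 * x)] != 0 -> M != 0 -> (forall y, -1 <= y <= 1 -> 0 <= M.[y]) ->
  changes_sign (cosSum a) x.
Proof.
move=> xI aE q0 M0 Mge.
have pi0 := pi_gt0 R.
apply: (@changes_sign_factor _ _ (fun t => cos (2 * t) - cos (2 * x))
  (fun t => cos t * q.[cos (2 * t)]) (fun t => cos (2 * t)) M) => //.
- by move=> t; rewrite cosPolyE aE !hornerM hornerXsubC; ring.
- by move=> t; apply/Mge/cos_range.
- exact: continuous_cos_double.
- by apply: continuousM; [exact: continuous_cos|exact: continuous_horner_cos].
- by rewrite mulf_neq0 // gt_eqF // cos_gt0_pihalf //; lra.
- by rewrite subrr.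
- have : x \in `]0, pi / 2[ by rewrite in_itv.
  move/near_in_itvoo; apply: filterS => t; rewrite in_itv /= => tI tx.
  have h : cos (2 * x) < cos (2 * t) by rewrite ltr_cos ?in_itv /=; lra.
  by rewrite subr_gt0 h gt_eqF.
- have : x \in `]0, pi / 2[ by rewrite in_itv.
  move/near_in_itvoo; apply: filterS => t; rewrite in_itv /= => tI tx.
  have h : cos (2 * t) < cos (2 * x) by rewrite ltr_cos ?in_itv /=; lra.
  by rewrite subr_lt0 h lt_eqF.
Qed.

(** Here cos t is the factor that changes sign, so pi / 2 is a sign change of C even if M vanishes
    at -1. *)
Lemma changes_sign_pihalf (R : realType) n (a : 'rV[R]_n) (q M : {poly R}) :
  cosPoly a = q * M ->
  q.[-1] != 0 -> M != 0 -> (forall y, -1 <= y <= 1 -> 0 <= M.[y]) ->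
  changes_sign (cosSum a) (pi / 2).
Proof.
move=> aE q0 M0 Mge.
have pi0 := pi_gt0 R.
have c2 : cos (2 * (pi / 2)) = -1 :> R by rewrite mulrC divfK ?cospi.
apply: (@changes_sign_factor _ _ (fun t => cos t)
  (fun t => q.[cos (2 * t)]) (fun t => cos (2 * t)) M) => //.
- by move=> t; rewrite cosPolyE aE !hornerM; ring.
- by move=> t; apply/Mge/cos_range.
- exact: continuous_cos_double.
- exact: continuous_horner_cos.
- by rewrite c2.
- exact: cos_pihalf.
- have : pi / 2 \in `]0, (pi : R)[ by rewrite in_itv /=; lra.
  move/near_in_itvoo; apply: filterS => t; rewrite in_itv /= => tI tx.
  have h : 0 < cos t by apply: cos_gt0_pihalf; lra.
  by split => //; rewrite c2 cos_double -subr_eq0 opprK subrK gt_eqF // mulr_gt0 // exprn_gt0.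
- have : pi / 2 \in `]0, (pi : R)[ by rewrite in_itv /=; lra.
  move/near_in_itvoo; apply: filterS => t; rewrite in_itv /= => tI tx.
  have h : cos t < 0 by rewrite -(cos_pihalf R) ltr_cos ?in_itv /=; lra.
  split => //; rewrite c2 cos_double -subr_eq0 opprK subrK gt_eqF // mulr_gt0 //.
  by rewrite exprn_even_gt0 //= lt_eqF.
Qed.

Lemma normalized_cosPoly_neq0 (R : realType) n (a : 'rV[R]_n) :
  normalized a -> cosPoly a != 0.
Proof.
move=> na; apply/eqP => a0; have := cosPoly1 a.
by rewrite a0 horner0 na => /esym/eqP; rewrite oner_eq0.
Qed.

(** Each r in [s] is realized at [acos r / 2] and -1 at pi / 2, points where the sine is positive.
    The order is decreasing, as [altPoly] expects. *)
Lemma cosPoly_sign_changes (R : realType) n (a : 'rV[R]_n) : normalized a ->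
  exists s M, [/\ sorted >%R s, all (fun r => -1 < r < 1) s,
    cosPoly a = \prod_(r <- s) ('X - r%:P) * M,
    (forall y, -1 <= y <= 1 -> 0 <= M.[y]) &
    forall r, r \in rcons s (-1) -> exists x,
      [/\ 0 < sin x <= 1, cos (2 * x) = r & changes_sign (cosSum a) x]].
Proof.
move=> na; have a0 := normalized_cosPoly_neq0 na.
have [s0 [M [us0 s0I aE MM]]] := poly_sign_change_split a0.
pose s := rev (sort <=%R s0).
have ps : perm_eq s s0 by rewrite perm_rev perm_sort.
have us : uniq s by rewrite (perm_uniq ps).
have sI r : r \in s -> -1 < r < 1 by rewrite (perm_mem ps) => /(allP s0I).
have {}aE : cosPoly a = \prod_(r <- s) ('X - r%:P) * M by rewrite aE (perm_big _ ps).
have M0 : M != 0 by apply: contraNneq a0 => M0; rewrite aE M0 mulr0.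
have Mge y : -1 <= y <= 1 -> 0 <= M.[y].
  (* N(1) = 1 and the factors 1 - r are positive, so M(1) > 0 decides the common sign of the values
     of M. *)
  move=> yI; have M1 : 0 < M.[1].
    have := cosPoly1 a; rewrite na aE hornerM horner_prod => h.
    have : 0 < (\prod_(r <- s) ('X - r%:P).[1]) * M.[1] by rewrite h ltr01.
    rewrite pmulr_rgt0 //; rewrite big_seq prodr_gt0 // => r /sI.
    by rewrite hornerXsubC; lra.
  by have := MM y 1 yI; rewrite pmulr_lge0 //; apply; lra.
exists s, M; split=> //.
- by rewrite rev_sorted sort_lt_sorted.
- exact/allP.
move=> r; rewrite mem_rcons inE => /orP[/eqP ->|rs].
  exists (pi / 2); split.
  - by rewrite sin_pihalf ltr01 lexx.
  - by rewrite mulrC divfK ?cospi.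
  - apply: (changes_sign_pihalf aE) => //; rewrite horner_prod.
    rewrite prodf_seq_neq0; apply/allP => z /sI zI.
    by rewrite hornerXsubC /= lt_eqF //; lra.
have rI := sI _ rs.
have cr : cos (2 * (acos r / 2)) = r.
  by rewrite mulrC divfK // acosK // in_itv /=; lra.
have h1 : 0 < acos r by apply: acos_gt0; lra.
have h2 : acos r < pi by apply: acos_ltpi; lra.
exists (acos r / 2); split=> //.
  by rewrite sin_le1 andbT; apply: sin_gt0_pihalf; lra.
apply: (@changes_sign_interior _ _ _ _ (\prod_(r' <- rem r s) ('X - r'%:P)) M) => //.
- by lra.
- by rewrite cr aE (perm_big _ (perm_to_rem rs)) big_cons.
- rewrite cr -rootE root_prod_XsubC mem_rem_uniq // !inE eqxx //.
Qed.

(** * The lower bound by duality *)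

(** The node with m = 0 is the point 1, and the other nodes contribute nonnegative terms. *)
Lemma nodeMean_ge (R : realType) n (p : {poly R}) : (0 < n)%N ->
  (forall y, -1 <= y <= 1 -> 0 <= p.[y]) -> p.[1] / n%:R <= nodeMean n p.
Proof.
case: n => // n _ pge; rewrite /nodeMean mulrC ler_pM2l ?invr_gt0 ?ltr0n //.
rewrite big_ord_recl /nodeAngle /= !mul0r mulr0 cos0 lerDl sumr_ge0 // => i _.
exact/pge/cos_range.
Qed.

(** Equality case of [nodeMean_ge]: a sum of nonnegative terms that is at most zero vanishes
    termwise. *)
Lemma nodeMean_min (R : realType) n (p : {poly R}) : (0 < n)%N ->
  (forall y, -1 <= y <= 1 -> 0 <= p.[y]) -> nodeMean n p <= p.[1] / n%:R ->
  forall m, (0 < m < n)%N -> p.[cos (2 * nodeAngle R n m)] = 0.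
Proof.
case: n => // n _ pge; rewrite /nodeMean mulrC ler_pM2r ?invr_gt0 ?ltr0n //.
rewrite big_ord_recl {1}/nodeAngle /= !mul0r mulr0 cos0 gerDl => sle m mI.
have mn : (m.-1 < n)%N by lia.
have ge0 (i : 'I_n) : true -> 0 <= p.[cos (2 * nodeAngle R n.+1 (lift ord0 i))].
  by move=> _; apply/pge/cos_range.
have S0 : \sum_(i < n) p.[cos (2 * nodeAngle R n.+1 (lift ord0 i))] = 0.
  by apply/le_anti; rewrite sle sumr_ge0.
have := psumr_eq0P ge0 S0 (i := Ordinal mn) isT.
by rewrite lift0 /= prednK //; case/andP: mI.
Qed.

(** The right-hand side is m / sin^2 x, and W sin^2 x <= |S| sin x <= |S|. *)
Lemma sinQuotSum_le (R : realType) n (a : 'rV[R]_n) (x m : R) :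
  0 < sin x <= 1 -> `|sinSum a x| <= m ->
  sinQuotSum a (cos (2 * x)) <= m * (2 / (1 - cos (2 * x))).
Proof.
rewrite sinQuotSumE cos_double cos2sin2 => /andP[s0 s1]; set W := sinQuotSum _ _.
rewrite normrM gtr0_norm // => h.
have -> : 1 - (2 * (1 - sin x ^+ 2) - 1) = 2 * sin x ^+ 2 by ring.
have -> : 2 / (2 * sin x ^+ 2) = (sin x ^+ 2)^-1 by field; rewrite gt_eqF.
rewrite ler_pdivlMr ?exprn_gt0 //.
apply: (@le_trans _ _ (sin x * `|W| * sin x)).
  by have := ler_wpM2r (sqr_ge0 (sin x)) (ler_norm W); lra.
have p0 : 0 <= sin x * `|W| by rewrite mulr_ge0 // ltW.
by apply: le_trans h; rewrite ler_piMr.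
Qed.

(** Strictness comes from m sin x < m. *)
Lemma sinQuotSum_lt (R : realType) n (a : 'rV[R]_n) (x m : R) :
  0 < sin x < 1 -> 0 < m -> `|sinSum a x| <= m ->
  sinQuotSum a (cos (2 * x)) < m * (2 / (1 - cos (2 * x))).
Proof.
rewrite sinQuotSumE cos_double cos2sin2 => /andP[s0 s1] m0; set W := sinQuotSum _ _.
rewrite normrM gtr0_norm // => h.
have -> : 1 - (2 * (1 - sin x ^+ 2) - 1) = 2 * sin x ^+ 2 by ring.
have -> : 2 / (2 * sin x ^+ 2) = (sin x ^+ 2)^-1 by field; rewrite gt_eqF.
rewrite ltr_pdivlMr ?exprn_gt0 //.
apply: (@le_lt_trans _ _ (sin x * `|W| * sin x)).
  by have := ler_wpM2r (sqr_ge0 (sin x)) (ler_norm W); lra.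
apply: (@le_lt_trans _ _ (m * sin x)); first by rewrite ler_pM2r.
by rewrite gtr_pMr.
Qed.

(** With m arbitrary this serves twice: the weak inequality is the lower bound, and the strict one
    forces an extremal N to have no sign change inside ]-1, 1[. *)
Lemma sinSum_sign_change_bound (R : realType) n (a : 'rV[R]_n) (s : seq R)
    (M : {poly R}) (m : R) : (0 < n)%N -> normalized a ->
  sorted >%R s -> all (fun r => -1 < r < 1) s ->
  cosPoly a = \prod_(r <- s) ('X - r%:P) * M ->
  (forall y, -1 <= y <= 1 -> 0 <= M.[y]) ->
  (forall r, r \in rcons s (-1) -> exists x,
     [/\ 0 < sin x <= 1, cos (2 * x) = r & `|sinSum a x| <= m]) ->
  n%:R^-1 <= m /\ (s != [::] -> n%:R^-1 < m).
Proof.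
move=> n0 na ss /allP sI aE Mge hx.
pose S := rcons s (-1).
have SI r : r \in S -> -1 <= r < 1.
  by rewrite mem_rcons inE => /orP[/eqP ->|/sI]; lra.
have sS : sorted >%R S.
  rewrite /S -[rcons _ _]revK rev_sorted rev_rcons /= path_sortedE; last exact: lt_trans.
  rewrite -rev_sorted revK ss andbT; apply/allP => r; rewrite mem_rev => /sI.
  by lra.
have uS : uniq S by apply: sorted_uniq sS; [apply/rev_trans/lt_trans|move=> x; rewrite /= ltxx].
pose L := altPoly S.
have S0 : S != [::] by rewrite -size_eq0 size_rcons.
pose lam r := L.[r] / \prod_(r' <- rem r S) (r - r').
have LE : L = \sum_(r <- S) lam r *: \prod_(r' <- rem r S) ('X - r'%:P).
  exact: lagrange_interpolation uS (size_altPoly S0).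
have lam_ge0 r : r \in S -> 0 <= lam r.
  move=> rS; have := altPoly_weight_ge0 sS rS; rewrite -/L /lam; set B := \prod_(_ <- _) _ => h.
  (* Writing the quotient as a product times a square reduces the claim to [altPoly_weight_ge0]. *)
  have -> : L.[r] / B = L.[r] * B * B^-1 ^+ 2.
    have [->|B0] := eqVneq B 0; first by rewrite invr0 !mulr0 mul0r.
    by field.
  by rewrite mulr_ge0 ?sqr_ge0.
pose G r := \prod_(r' <- rem r S) ('X - r'%:P) * M.
(* The factor X + 1 accounts for the point -1 appended to [s]. *)
have PE : ('X + 1) * cosPoly a = \prod_(r <- S) ('X - r%:P) * M.
  by rewrite aE big_rcons /= polyCN opprK; ring.
have GW r : r \in S -> nodeMean n (G r) = sinQuotSum a r.
  move=> rS; apply: nodeMean_divided_difference.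
  by rewrite PE (perm_big _ (perm_to_rem rS)) big_cons mulrA.
have L1 : 0 < L.[1] by apply: altPoly_gt0; apply/allP => r /SI; lra.
(* P(1) = 2 N(1) = 2 is the origin of the numerator in 2 / (1 - r). *)
have PM : \prod_(r <- S) (1 - r) * M.[1] = 2.
  have := congr1 (horner^~ 1) PE.
  rewrite !hornerM hornerD hornerX hornerC cosPoly1 na mulr1 horner_prod.
  by under eq_bigr do rewrite hornerXsubC; move=> <-.
have Q1 : 0 < \prod_(r <- S) (1 - r).
  by apply: prod_sub_gt0; apply/allP => r /SI; lra.
have M1 : 0 < M.[1] by rewrite -(pmulr_rgt0 _ Q1) PM.
have LM1 : L.[1] * M.[1] = \sum_(r <- S) lam r * (2 / (1 - r)).
  rewrite LE horner_sum mulr_suml big_seq [RHS]big_seq; apply: eq_bigr => r rS.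
  have r1 : 1 - r != 0 by have := SI r rS; lra.
  rewrite hornerZ -mulrA; congr (_ * _); apply: (mulfI r1).
  have -> : (1 - r) * (2 / (1 - r)) = 2 by field.
  rewrite -PM (perm_big _ (perm_to_rem rS)).
  rewrite big_cons horner_prod; under eq_bigr do rewrite hornerXsubC.
  by rewrite mulrA.
(* The product [L * M] is nonnegative on [-1, 1], so the node 1 alone bounds its mean from below;
   expanding L by its weights turns this mean into values of W. *)
have LMW : L.[1] * M.[1] / n%:R <= \sum_(r <- S) lam r * sinQuotSum a r.
  have -> : \sum_(r <- S) lam r * sinQuotSum a r = nodeMean n (L * M).
    rewrite LE mulr_suml nodeMean_sum big_seq [RHS]big_seq; apply: eq_bigr => r rS.
    by rewrite -[_ * M]scalerAl nodeMeanZ GW.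
  rewrite -hornerM; apply: nodeMean_ge => // y yI; rewrite hornerM mulr_ge0 ?Mge //.
  by apply: altPoly_ge0; rewrite last_rcons; case/andP: yI.
have le r : r \in S -> sinQuotSum a r <= m * (2 / (1 - r)).
  by case/hx=> x [sx <- xm]; apply: sinQuotSum_le.
have main : n%:R^-1 <= m.
  rewrite -(ler_pM2l (mulr_gt0 L1 M1)); apply: (le_trans LMW).
  rewrite LM1 mulr_suml big_seq [leRHS]big_seq; apply: ler_sum => r rS.
  by rewrite -[leRHS]mulrA [_ * m]mulrC ler_wpM2l ?lam_ge0 // le.
split=> // sN0; have m0 : 0 < m by apply: lt_le_trans main; rewrite invr_gt0 ltr0n.
rewrite -(ltr_pM2l (mulr_gt0 L1 M1)); apply: (le_lt_trans LMW).
rewrite LM1 mulr_suml.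
have -> : \sum_(r <- S) lam r * (2 / (1 - r)) * m = \sum_(r <- S) lam r * (m * (2 / (1 - r))).
  by apply: eq_bigr => r _; ring.
(* The strict term is that of the largest sign change r0: its weight is positive, and r0 > -1 rules
   out sin x = 1. *)
case sE : s sN0 => [|r0 s'] // _.
have SE : S = r0 :: rcons s' (-1) by rewrite /S sE.
have r0S : r0 \in S by rewrite SE mem_head.
rewrite SE !big_cons; apply: ltr_leD.
  have lam0 : 0 < lam r0.
    have Lr0 : 0 < L.[r0] by rewrite /L SE; apply: altPoly_head_gt0; rewrite -SE.
    rewrite /lam divr_gt0 // SE /= eqxx; apply: prod_sub_gt0.
    by move: sS; rewrite SE gt_sorted_cons => /andP[].
  rewrite ltr_pM2l //; have [x [sx cx xm]] := hx _ r0S; rewrite -cx.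
  apply: sinQuotSum_lt => //; case/andP: sx => -> sx /=.
  rewrite lt_neqAle sx andbT; apply/negP => /eqP s1.
  have : -1 < r0 by have := sI r0; rewrite sE mem_head => /(_ isT); lra.
  by rewrite -cx cos_double cos2sin2 s1; lra.
rewrite big_seq [leRHS]big_seq; apply: ler_sum => r rS.
have {}rS : r \in S by rewrite SE inE rS orbT.
by rewrite ler_wpM2l ?lam_ge0 // le.
Qed.

(** * Existence of the maximum *)

Lemma finite_poly_roots (R : idomainType) (p : {poly R}) : p != 0 ->
  exists rs : seq R, forall x, root p x -> x \in rs.
Proof.
have [k] := ubnP (size p); elim: k p => // k IH p szp p0.
have [[r rp]|nor] := pselect (exists r, root p r); last first.
  by exists [::] => x px; case: nor; exists x.
have [q pE] := factor_theorem p r rp.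
have q0 : q != 0 by apply: contraNneq p0 => q0; rewrite pE q0 mul0r.
have [|rs rsP] := IH q _ q0.
  by move: szp; rewrite pE size_Mmonic ?monicXsubC // size_XsubC; lia.
exists (r :: rs) => x; rewrite pE rootM root_XsubC inE => /orP[/rsP ->|->//].
by rewrite orbT.
Qed.

(** Induction on the list: the maximum of [A] without [v] is compared with [v]. *)
Lemma sub_seq_is_maximum (R : realType) (V : seq R) (A : set R) :
  (forall x, A x -> x \in V) -> A !=set0 -> exists m, is_maximum A m.
Proof.
elim: V A => [|v V IH] A AV [x0 Ax0]; first by have := AV _ Ax0.
have [|nv] := pselect (exists x, A x /\ x != v); last first.
  have Ev x : A x -> x = v.
    by move=> Ax; apply: contrapT => /eqP xv; apply: nv; exists x.
  by exists v; split=> [|x /Ev ->//]; rewrite -(Ev x0).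
case=> x1 [Ax1 x1v].
have [||m [[Am mv] mub]] := IH [set x | A x /\ x != v].
- by move=> x [/AV]; rewrite inE => /orP[/eqP ->|//]; rewrite eqxx.
- by exists x1.
have [Av|nAv] := pselect (A v); last first.
  exists m; split=> // x Ax; apply: mub; split=> //.
  by apply: contra_notN nAv => /eqP <-.
have [vm|mv'] := leP v m.
  by exists m; split=> // x Ax; have [->//|xv] := eqVneq x v; apply: mub.
exists v; split=> // x Ax; have [->//|xv] := eqVneq x v.
by apply: (le_trans _ (ltW mv')); apply: mub.
Qed.

(** In this form |S| depends on t only through cos 2t, so infinitely many sign changes give finitely
    many values. *)
Lemma norm_sinSum (R : realType) n (a : 'rV[R]_n) t :
  `|sinSum a t| =
  Num.sqrt ((1 - cos (2 * t)) / 2) * `|sinQuotSum a (cos (2 * t))|.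
Proof.
rewrite sinQuotSumE normrM -sqrtr_sqr; congr (Num.sqrt _ * _).
by rewrite cos_double cos2sin2; field.
Qed.

(** At a zero of C, cos 2t is a root of (1 + X) N, the case cos t = 0 giving -1. The set is nonempty
    because -1 is always realized by a sign change. *)
Lemma sign_change_values_maximum (R : realType) n (a : 'rV[R]_n) :
  normalized a -> exists m, is_maximum (sign_change_values a) m.
Proof.
move=> na; have [s [M [_ _ _ _ hx]]] := cosPoly_sign_changes na.
have P0 : ('X + 1) * cosPoly a != 0.
  by rewrite mulf_neq0 ?normalized_cosPoly_neq0 // -polyC1 -[1]opprK polyCN polyXsubC_eq0.
have [rs rsP] := finite_poly_roots P0.
apply: (@sub_seq_is_maximum _
  [seq Num.sqrt ((1 - y) / 2) * `|sinQuotSum a y| | y <- rs]).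
  move=> v [t [ct _] <-]; rewrite norm_sinSum.
  apply: (map_f (fun y => Num.sqrt ((1 - y) / 2) * `|sinQuotSum a y|)).
  apply: rsP; rewrite rootM; move/eqP: ct; rewrite cosPolyE mulf_eq0.
  case/orP=> [/eqP c0|]; last by rewrite -rootE => ->; rewrite orbT.
  by rewrite rootE hornerD hornerX hornerC cos_double c0 expr0n mulr0 sub0r addNr eqxx.
have [|x [_ _ cx]] := hx (-1); first by rewrite mem_rcons mem_head.
by exists `|sinSum a x|; exists x.
Qed.

(** * The extremal coefficients from the Fejer kernel *)

(** The numerator 2n - (2j + 1) is proportional to the Fejer weight of the frequency 2j + 1, and n^2
    is the sum of the first n odd numbers. *)
Definition fejerRow (R : realType) n : 'rV[R]_n :=
  \row_(j < n) ((2 * n%:R - 2 * j%:R - 1) / n%:R ^+ 2).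

(** From n to n + 1 every old weight grows by 2 and the new weight is 1; this drives the inductions
    below. *)
Lemma fejer_sumS (R : realType) (f : nat -> R) n :
  \sum_(j < n.+1) (2 * n.+1%:R - 2 * j%:R - 1) * f j =
  \sum_(j < n) (2 * n%:R - 2 * j%:R - 1) * f j + 2 * \sum_(j < n) f j + f n.
Proof.
rewrite big_ord_recr /= mulr_sumr -big_split /=; congr (_ + _).
  by apply: eq_bigr => j _; rewrite -natr1; ring.
by rewrite -natr1; ring.
Qed.

Lemma fejer_sum1 (R : realType) n :
  \sum_(j < n) (2 * n%:R - 2 * j%:R - 1) * 1 = n%:R ^+ 2 :> R.
Proof.
elim: n => [|n IH]; first by rewrite big_ord0 expr0n.
by rewrite (fejer_sumS (fun=> 1)) IH sumr_const card_ord -natr1; ring.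
Qed.

Lemma fejer_sum_alt (R : realType) n :
  \sum_(j < n) (2 * n%:R - 2 * j%:R - 1) * (-1) ^+ j = n%:R :> R.
Proof.
have alt k : 2 * \sum_(j < k) (-1) ^+ j + (-1) ^+ k = 1 :> R.
  elim: k => [|k IH]; first by rewrite big_ord0 mulr0 add0r.
  by rewrite big_ord_recr /= exprS; lra.
elim: n => [|n IH]; first by rewrite big_ord0.
by rewrite (fejer_sumS (fun j => (-1) ^+ j)) IH -addrA alt natr1.
Qed.

(** In the induction the increment contains the plain sum of cosines, which [dir] evaluates by
    telescoping against sin t. *)
Lemma fejer_sum_cos (R : realType) n (t : R) :
  (\sum_(j < n) (2 * n%:R - 2 * j%:R - 1) * cos ((2 * j + 1)%:R * t)) * sin t ^+ 2 =
  sin (n%:R * t) ^+ 2 * cos t.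
Proof.
have dir k : 2 * (\sum_(j < k) cos ((2 * j + 1)%:R * t)) * sin t =
    sin (2 * (k%:R * t)).
  elim: k => [|k IH]; first by rewrite big_ord0 mul0r !mulr0 mul0r sin0.
  rewrite big_ord_recr /= mulrDr mulrDl IH.
  have -> : 2 * (k.+1%:R * t) = (2 * k + 1)%:R * t + t.
    by rewrite -natr1 natrD natrM; ring.
  have -> : 2 * (k%:R * t) = (2 * k + 1)%:R * t - t.
    by rewrite natrD natrM; ring.
  by rewrite sinB sinD; ring.
elim: n => [|n IH]; first by rewrite big_ord0 mul0r mul0r sin0 expr0n mul0r.
have /= -> := fejer_sumS (fun j => cos ((2 * j + 1)%:R * t)) n.
rewrite mulrDl [X in X + _]mulrDl IH.
rewrite [2 * _ * sin t ^+ 2]mulrA dir.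
have -> : n.+1%:R * t = n%:R * t + t by rewrite -natr1; ring.
have -> : (2 * n + 1)%:R * t = 2 * (n%:R * t) + t by rewrite natrD natrM; ring.
(* What remains is sin^2 x cos t + sin 2x sin t + cos (2x + t) sin^2 t = sin^2 (x + t) cos t. *)
set x := n%:R * t; rewrite !sinD !cosD cos_double mulr_natl sin_mulr2n.
have cx := cos2sin2 x; have ct := cos2sin2 t.
ring: cx ct.
Qed.

Lemma fejer_normalized (R : realType) n : (0 < n)%N -> normalized (fejerRow R n).
Proof.
move=> n0; rewrite /normalized (eq_bigr (fun j : 'I_n =>
  (2 * n%:R - 2 * j%:R - 1) * 1 / n%:R ^+ 2)) => [|j _]; last by rewrite mxE mulr1.
by rewrite -mulr_suml fejer_sum1 divff // expf_neq0 // pnatr_eq0 -lt0n.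
Qed.

Lemma fejer_sinSum_pihalf (R : realType) n : (0 < n)%N ->
  sinSum (fejerRow R n) (pi / 2) = n%:R^-1.
Proof.
move=> n0; rewrite /sinSum (eq_bigr (fun j : 'I_n =>
  (2 * n%:R - 2 * j%:R - 1) * (-1) ^+ j / n%:R ^+ 2)) => [|j _].
  have ? : n%:R != 0 :> R by rewrite pnatr_eq0 -lt0n.
  by rewrite -mulr_suml fejer_sum_alt; field.
have -> : (2 * j + 1)%:R * (pi / 2) = j%:R * pi + pi / 2 :> R.
  by rewrite natrD natrM; field.
by rewrite sinDpihalf cos_natMpi mxE mulrAC.
Qed.

Lemma fejer_cosSum (R : realType) n (t : R) : (0 < n)%N ->
  cosSum (fejerRow R n) t * (n%:R * sin t) ^+ 2 = sin (n%:R * t) ^+ 2 * cos t.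
Proof.
move=> n0; have nz : n%:R != 0 :> R by rewrite pnatr_eq0 -lt0n.
rewrite -fejer_sum_cos exprMn mulrA; congr (_ * _); rewrite mulr_suml.
by apply: eq_bigr => j _; rewrite mxE; field.
Qed.

(** Where sin t is nonzero the closed form decides. Where sin t = 0 it degenerates to 0 = 0, and
    N(1) = 1 gives C(t) = cos t instead. *)
Lemma fejer_cosSum_sign (R : realType) n (t : R) : (0 < n)%N ->
  0 <= cosSum (fejerRow R n) t * cos t.
Proof.
move=> n0; have [s0|s0] := eqVneq (sin t) 0.
  have c2 : cos (2 * t) = 1 by rewrite cos_double cos2sin2 s0; ring.
  rewrite cosPolyE c2 cosPoly1 (fejer_normalized R n0) mulr1 -expr2.
  exact: sqr_ge0.
have h : 0 < (n%:R * sin t) ^+ 2 :> R.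
  by rewrite exprn_even_gt0 //= mulf_neq0 // pnatr_eq0 -lt0n.
rewrite -(pmulr_lge0 _ h) mulrAC fejer_cosSum //.
have -> : sin (n%:R * t) ^+ 2 * cos t * cos t = (sin (n%:R * t) * cos t) ^+ 2 by ring.
exact: sqr_ge0.
Qed.

(** If cos t were nonzero, C would take the sign opposite to that of the cosine on one side of t,
    against [fejer_cosSum_sign]. *)
Lemma fejer_changes_sign (R : realType) n (t : R) : (0 < n)%N ->
  changes_sign (cosSum (fejerRow R n)) t -> cos t = 0.
Proof.
move=> n0 [_ ch]; apply/eqP/contraT => c0; exfalso.
pose f := cosSum (fejerRow R n).
have contra (F : set_system R) : ProperFilter F -> F --> t ->
    (\forall x \near F, f x * cos t < 0) -> False.
  move=> FF Ft fneg.
  have cc : \forall x \near F, 0 < cos x * cos t.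
    apply: Ft; have cM : {for t, continuous (fun x : R => cos x * cos t)}.
      by apply: continuousM; [exact: continuous_cos|exact: cst_continuous].
    by apply: (cvgr_gt _ cM); rewrite -expr2 exprn_even_gt0.
  have [x [fx cx]] := filter_ex (filterI fneg cc).
  have := @fejer_cosSum_sign R n x n0; rewrite -/(f x) => fc.
  have : f x * cos x * (cos t) ^+ 2 < 0.
    have -> : f x * cos x * (cos t) ^+ 2 = (f x * cos t) * (cos x * cos t) by ring.
    by rewrite nmulr_rlt0.
  by rewrite ltNge mulr_ge0 ?sqr_ge0.
have tl : t^'- --> t by apply: cvg_within.
have tr : t^'+ --> t by apply: cvg_within.
have [cn|cp|/eqP] := ltgtP (cos t) 0; last by rewrite (negPf c0).
- case: ch => -[l r]; [apply: (contra _ _ tr)|apply: (contra _ _ tl)].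
    by apply: filterS r => x fx; rewrite nmulr_llt0.
  by apply: filterS l => x fx; rewrite nmulr_llt0.
- case: ch => -[l r]; [apply: (contra _ _ tl)|apply: (contra _ _ tr)].
    by apply: filterS l => x fx; rewrite pmulr_llt0.
  by apply: filterS r => x fx; rewrite pmulr_llt0.
Qed.

(** At every sign change cos t = 0, hence cos 2t = -1, and by [norm_sinSum] |S| has its value at pi
    / 2. *)
Lemma fejer_maximum (R : realType) n : (0 < n)%N ->
  is_maximum (sign_change_values (fejerRow R n)) (1 / n%:R).
Proof.
move=> n0; rewrite div1r.
have val t : cos t = 0 -> `|sinSum (fejerRow R n) t| = n%:R^-1.
  move=> c0; rewrite norm_sinSum cos_double c0 expr0n mulr0 sub0r.
  rewrite -[RHS]ger0_norm ?invr_ge0 // -(fejer_sinSum_pihalf R n0) norm_sinSum.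
  by rewrite cos_double cos_pihalf expr0n mulr0 sub0r.
split; last by move=> _ [t /(fejer_changes_sign n0) ct <-]; rewrite val.
have [s [M [_ _ _ _ hx]]] := cosPoly_sign_changes (fejer_normalized R n0).
have [|x [_ _ cx]] := hx (-1); first by rewrite mem_rcons mem_head.
by exists x => //; rewrite val //; apply: fejer_changes_sign cx.
Qed.

(** * Uniqueness by discrete orthogonality at the nodes *)

(** Beyond n the frequencies alias: i and 2n - i give the same cosine at every node, and for i = n
    each term is 1. *)
Lemma sum_cos_nodes_ext (R : realType) n i : (i < n.*2)%N ->
  \sum_(m < n) cos (i%:R * (2 * nodeAngle R n m)) =
  n%:R * ((i == 0%N) || (i == n))%:R.
Proof.
move=> i2n; have [->|i0] := eqVneq i 0%N.
  rewrite (eq_bigr (fun=> 1)) => [|m _]; last by rewrite mul0r cos0.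
  by rewrite sumr_const card_ord mulr1.
have n0 : (n%:R : R) != 0 by rewrite pnatr_eq0; lia.
have [->|iN] := eqVneq i n.
  rewrite (eq_bigr (fun=> 1)) => [|m _]; first by rewrite sumr_const card_ord mulr1.
  have -> : n%:R * (2 * nodeAngle R n m) = (2 * m)%:R * pi.
    by rewrite natrM /nodeAngle; field.
  by rewrite cos_natMpi exprM sqrrN expr1n expr1n.
rewrite mulr0; have [ltin|lein] := ltnP i n; first by apply: sum_cos_nodes; lia.
rewrite -[RHS](@sum_cos_nodes R n (n.*2 - i)); last by lia.
apply: eq_bigr => m _.
have -> : (n.*2 - i)%:R * (2 * nodeAngle R n m) =
    (2 * (2 * m))%:R * pi - i%:R * (2 * nodeAngle R n m).
  rewrite natrB; last by lia.
  by rewrite -mul2n !natrM /nodeAngle; field.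
by rewrite cosB cos_natMpi sin_natMpi exprM sqrrN !expr1n mul1r mul0r addr0.
Qed.

(** In the doubled angle the frequencies are j + k + 1, between 1 and 2n - 1, and |j - k| < n. The
    former equals n exactly when j is the mirror index [rev_ord k]. *)
Lemma sum_cos_nodes_sum_diff (R : realType) n (j k : 'I_n) :
  \sum_(m < n) cos ((2 * j + 1)%:R * nodeAngle R n m + (2 * k + 1)%:R * nodeAngle R n m)
    = n%:R * (j == rev_ord k)%:R /\
  \sum_(m < n) cos ((2 * j + 1)%:R * nodeAngle R n m - (2 * k + 1)%:R * nodeAngle R n m)
    = n%:R * (j == k)%:R.
Proof.
have jn := ltn_ord j; have kn := ltn_ord k; split.
  rewrite (eq_bigr (fun m : 'I_n => cos ((j + k + 1)%:R * (2 * nodeAngle R n m)))).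
    rewrite sum_cos_nodes_ext; last by lia.
    by congr (_ * _%:R); rewrite -val_eqE /=; lia.
  by move=> m _; congr cos; rewrite ![(_ * _ + 1)%:R]natrD ![(2 * _)%:R]natrM !natrD; ring.
wlog kj : j k jn kn / (k <= j)%N.
  move=> wl; have [kj|/ltnW jk] := leqP k j; first exact: wl.
  rewrite eq_sym -wl //; apply: eq_bigr => m _.
  by rewrite -cosN opprB.
rewrite (eq_bigr (fun m : 'I_n => cos ((j - k)%:R * (2 * nodeAngle R n m)))).
  rewrite sum_cos_nodes_ext; last by lia.
  by congr (_ * _%:R); rewrite -val_eqE /=; lia.
by move=> m _; congr cos; rewrite natrB // ![(_ * _ + 1)%:R]natrD ![(2 * _)%:R]natrM; ring.
Qed.

Lemma sum_pick (R : realType) n (c : 'I_n -> R) (k : 'I_n) :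
  \sum_(j < n) c j * (n%:R * (j == k)%:R) = n%:R * c k.
Proof.
by rewrite (bigD1 k) //= eqxx big1 ?addr0 ?mulr1 1?mulrC // => j /negPf ->; rewrite !mulr0.
Qed.

(** Testing the samples against the cosine of frequency 2k + 1 picks up k together with its alias
    [rev_ord k]; testing sine samples against sines gives the difference instead of the sum. *)
Lemma cos_nodes_antisym (R : realType) n (c : 'I_n -> R) :
  (forall m, (m < n)%N -> \sum_(j < n) c j * cos ((2 * j + 1)%:R * nodeAngle R n m) = 0) ->
  forall k, c k + c (rev_ord k) = 0.
Proof.
move=> h k; have n0 : (n%:R : R) != 0 by rewrite pnatr_eq0 -lt0n (leq_trans _ (ltn_ord k)).
apply: (mulfI n0); rewrite mulr0 mulrDr -!sum_pick -big_split /=.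
transitivity (\sum_(j < n) \sum_(m < n) 2 * (c j * cos ((2 * j + 1)%:R * nodeAngle R n m))
     * cos ((2 * k + 1)%:R * nodeAngle R n m)).
  apply: eq_bigr => j _; have [<- <-] := sum_cos_nodes_sum_diff R j k.
  rewrite -mulrDr -big_split mulr_sumr; apply: eq_bigr => m _ /=.
  by rewrite cosB cosD; ring.
rewrite exchange_big big1 // => m _.
by rewrite -mulr_suml -mulr_sumr h ?mulr0 ?mul0r.
Qed.

Lemma sin_nodes_sym (R : realType) n (c : 'I_n -> R) :
  (forall m, (m < n)%N -> \sum_(j < n) c j * sin ((2 * j + 1)%:R * nodeAngle R n m) = 0) ->
  forall k, c k = c (rev_ord k).
Proof.
move=> h k; have n0 : (n%:R : R) != 0 by rewrite pnatr_eq0 -lt0n (leq_trans _ (ltn_ord k)).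
apply: (mulfI n0); apply/eqP; rewrite -subr_eq0 -!sum_pick -sumrB; apply/eqP.
transitivity (\sum_(j < n) \sum_(m < n) 2 * (c j * sin ((2 * j + 1)%:R * nodeAngle R n m))
     * sin ((2 * k + 1)%:R * nodeAngle R n m)).
  apply: eq_bigr => j _; have [<- <-] := sum_cos_nodes_sum_diff R j k.
  rewrite -mulrBr -sumrB mulr_sumr; apply: eq_bigr => m _ /=.
  by rewrite cosB cosD; ring.
rewrite exchange_big big1 // => m _.
by rewrite -mulr_suml -mulr_sumr h ?mulr0 ?mul0r.
Qed.

Lemma is_derive_cosSum (R : realType) n (a : 'rV[R]_n) (t : R) :
  is_derive t 1 (cosSum a)
    (- \sum_(j < n) a ord0 j * (2 * j + 1)%:R * sin ((2 * j + 1)%:R * t)).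
Proof.
have dmul (c : R) : is_derive t 1 ( *%R c) c.
  have -> : *%R c = c \*: (id : R -> R) by [].
  by apply: is_derive_eq; rewrite /GRing.scale /= mulr1.
have -> : cosSum a = \sum_(j < n) (a ord0 j \*: (cos \o ( *%R (2 * j + 1)%:R))).
  by apply/funext => x; rewrite fct_sumE.
apply: is_derive_eq.
rewrite -sumrN; apply: eq_bigr => j _.
by rewrite /GRing.scale /=; ring.
Qed.

(** Equality in the bound excludes interior sign changes, so N >= 0. At y = -1 the divided
    difference of P is N itself, with mean W(-1) <= 1/n = N(1)/n, so [nodeMean_min] applies. *)
Lemma extremal_cosPoly_node (R : realType) n (a : 'rV[R]_n) : (0 < n)%N ->
  normalized a -> is_maximum (sign_change_values a) (1 / n%:R) ->
  (forall y, -1 <= y <= 1 -> 0 <= (cosPoly a).[y]) /\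
  forall m, (0 < m < n)%N -> (cosPoly a).[cos (2 * nodeAngle R n m)] = 0.
Proof.
move=> n0 na [_ ub]; have [s [M [ss sI aE Mge hx]]] := cosPoly_sign_changes na.
have hx' r : r \in rcons s (-1) -> exists x,
     [/\ 0 < sin x <= 1, cos (2 * x) = r & `|sinSum a x| <= n%:R^-1].
  by move=> /hx[x [? ? cx]]; exists x; split=> //; rewrite -div1r; apply: ub; exists x.
have [_ strict] := sinSum_sign_change_bound n0 na ss sI aE Mge hx'.
have s0 : s = [::] by apply/eqP; apply: contraT => /strict; rewrite ltxx.
have Nge y : -1 <= y <= 1 -> 0 <= (cosPoly a).[y].
  by rewrite aE s0 big_nil mul1r; apply: Mge.
split=> //; apply: nodeMean_min => //.
rewrite cosPoly1 na div1r (@nodeMean_divided_difference _ _ a (-1)); last first.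
  by rewrite polyCN opprK.
have [|x [sx cx xm]] := hx' (-1); first by rewrite mem_rcons mem_head.
have := sinQuotSum_le sx xm; rewrite cx.
have -> : 2 / (1 - -1) = 1 :> R by field.
by rewrite mulr1.
Qed.

(* The nonnegative function [cosPoly a] of [cos (2 * t)] has a minimum at each
   node, so both it and its derivative vanish there. *)
Lemma extremal_derivative_node (R : realType) n (a : 'rV[R]_n) : (0 < n)%N ->
  normalized a -> is_maximum (sign_change_values a) (1 / n%:R) ->
  forall m, (m < n)%N ->
  \sum_(j < n) a ord0 j * (2 * j + 1)%:R * sin ((2 * j + 1)%:R * nodeAngle R n m) = 0.
Proof.
move=> n0 na amax m mn; have [Nge N0] := extremal_cosPoly_node n0 na amax.
have [->|m0] := eqVneq m 0%N.
  by rewrite big1 // => j _; rewrite /nodeAngle !mul0r mulr0 sin0 mulr0.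
set x := nodeAngle R n m; pose f (t : R) := (cosPoly a).[cos (2 * t)].
have fx : f x = 0 by apply: N0; lia.
have df : is_derive x 1 f 0.
  apply: (@derive1_at_min _ f (x - 1) (x + 1)).
  - lra.
  - move=> t _.
    have d1 : is_derive t 1 (2 \*: (id : R -> R)) (2 *: 1) by exact: is_deriveZ.
    have d2 := @is_derive1_comp R cos _ t _ _ (is_derive_cos _) d1.
    have d3 := @is_derive1_comp R (horner (cosPoly a)) _ t _ _ (is_derive_poly _ _) d2.
    exact: (@ex_derive _ _ _ _ _ _ _ d3).
  - by rewrite in_itv /=; lra.
  - by move=> t _; rewrite fx; apply/Nge/cos_range.
have dC : is_derive x 1 (cosSum a) 0.
  have -> : cosSum a = cos * f by apply/funext => t; rewrite cosPolyE.
  by apply: is_derive_eq; rewrite fx scaler0 scale0r addr0.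
have := is_derive_cosSum a x => dC'.
have := @derive_val _ _ _ _ _ _ _ dC; rewrite (@derive_val _ _ _ _ _ _ _ dC').
by move/eqP; rewrite oppr_eq0 => /eqP.
Qed.

(** For the difference d of two solutions, the node values make d_j antisymmetric under index
    reversal and the derivatives make (2j + 1) d_j symmetric. The frequencies of j and its mirror
    add up to 2n, whence 2n d_j = 0. *)
Lemma extremal_unique (R : realType) n (a b : 'rV[R]_n) : (0 < n)%N ->
  normalized a -> is_maximum (sign_change_values a) (1 / n%:R) ->
  normalized b -> is_maximum (sign_change_values b) (1 / n%:R) -> a = b.
Proof.
move=> n0 na amax nb bmax.
have nodeC (c : 'rV[R]_n) m : normalized c -> is_maximum (sign_change_values c) (1 / n%:R) ->
    (m < n)%N -> cosSum c (nodeAngle R n m) = (m == 0%N)%:R.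
  move=> nc cmax mn; rewrite cosPolyE; have [->|m0] := eqVneq m 0%N.
    by rewrite /nodeAngle !mul0r mulr0 cos0 cosPoly1 nc mulr1.
  by have [_ ->] := extremal_cosPoly_node n0 nc cmax; rewrite ?mulr0 //; lia.
pose d (j : 'I_n) := a ord0 j - b ord0 j.
have dC m : (m < n)%N -> \sum_(j < n) d j * cos ((2 * j + 1)%:R * nodeAngle R n m) = 0.
  move=> mn; under eq_bigr do rewrite mulrBl.
  by rewrite sumrB -![\sum_(_ < n) _]/(cosSum _ _) !nodeC // subrr.
have dS m : (m < n)%N ->
    \sum_(j < n) (d j * (2 * j + 1)%:R) * sin ((2 * j + 1)%:R * nodeAngle R n m) = 0.
  move=> mn; under eq_bigr do rewrite !mulrBl.
  by rewrite sumrB !extremal_derivative_node // subrr.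
apply/rowP => j; apply/eqP; rewrite -subr_eq0 -[_ - _]/(d j); apply/eqP.
have e1 := cos_nodes_antisym dC j.
have e2 := sin_nodes_sym dS j.
have jn := ltn_ord j.
have rv : (2 * rev_ord j + 1)%:R = 2 * n%:R - (2 * j + 1)%:R :> R.
  by rewrite -natrM -natrB; [congr _%:R => /=; lia|lia].
have nz : 2 * n%:R != 0 :> R by rewrite mulf_neq0 // pnatr_eq0 -lt0n.
apply: (mulfI nz); rewrite mulr0; move: e2; rewrite rv.
have -> : d (rev_ord j) = - d j by lra.
by move=> e2; lra.
Qed.

Theorem mainTheorem4 (R : realType) (n : nat) (n_ge1 : (1 <= n)%N) :
  (forall a : 'rV[R]_n, normalized a ->
     exists m : R, is_maximum (sign_change_values a) m) /\
  is_minimum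
    [set m : R | exists a : 'rV[R]_n,
       normalized a /\ is_maximum (sign_change_values a) m]
    (1 / n%:R) /\
  (exists! a : 'rV[R]_n,
     normalized a /\ is_maximum (sign_change_values a) (1 / n%:R)).
Proof.
have fn := fejer_normalized R n_ge1; have fm := fejer_maximum R n_ge1.
split; first exact: sign_change_values_maximum.
split; last first.
  exists (fejerRow R n); split=> // b [nb bmax].
  exact: extremal_unique n_ge1 fn fm nb bmax.
split; first by exists (fejerRow R n).
move=> m [a [na [_ ub]]]; have [s [M [ss sI aE Mge hx]]] := cosPoly_sign_changes na.
rewrite div1r; apply: (sinSum_sign_change_bound n_ge1 na ss sI aE Mge _).1 => r.
by move=> /hx[x [? ? cx]]; exists x; split=> //; apply: ub; exists x.
Qed.
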